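(* Let $c>0$ be a fixed constant and let the numerical viscosity be $\beta = c h$, where $h>0$ is the mesh size. For each of the two schemes, the linearized viscous EPB-based scheme and the linearized viscous REPB-based scheme (both with time step $\delta>0$ and scaled Debye length $\lambda>0$), there exists a constant $C>0$, independent of $h$, of $\delta$ and of $\lambda$ (in particular not degenerating as $\lambda\to 0$), such that if $\delta \le C h$, then the scheme is stable, i.e. both characteristic roots $q^\lambda_\pm(\xi)$ of the scheme satisfy $$|q^\lambda_\pm(\xi)|\le 1 \quad \text{for all } \xi\in\mathbb{R} \text{ such that } |\xi|<\frac{\pi}{h}.$$
   Context: Parameters: $\lambda>0$ is the scaled Debye length, $\delta>0$ the time step, $h>0$ the mesh size, $\beta = c h$ a numerical viscosity coefficient with $c>0$ a constant. The space variable is $x\in\mathbb{R}$. The unknowns at time step $m\in\mathbb{N}$ are the functions $n^{\lambda,m}(x)$, $u^{\lambda,m}(x)$, $\phi^{\lambda,m}(x)$ (perturbations of density, velocity and potential). EPB stands for Euler-Poisson-Boltzmann and REPB for reformulated Euler-Poisson-Boltzmann. The linearized viscous EPB-based scheme is $$\delta^{-1}(n^{\lambda,m+1}-n^{\lambda,m})+\partial_x u^{\lambda,m}-\beta\,\partial_x^2 n^{\lambda,m}=0,$$ $$\delta^{-1}(u^{\lambda,m+1}-u^{\lambda,m})-\beta\,\partial_x^2 u^{\lambda,m}=\partial_x\phi^{\lambda,m+1},$$ $$\lambda^2\partial_x^2\phi^{\lambda,m+1}=n^{\lambda,m+1}+\phi^{\lambda,m+1}.$$ The linearized viscous REPB-based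 scheme is $$\delta^{-1}(n^{\lambda,m+1}-n^{\lambda,m})+\partial_x u^{\lambda,m}-\beta\,\partial_x^2 n^{\lambda,m}=0,$$ $$\delta^{-1}(u^{\lambda,m+1}-u^{\lambda,m})+\partial_x n^{\lambda,m}-\beta\,\partial_x^2 u^{\lambda,m}=\lambda^2\partial_x^3\phi^{\lambda,m+1},$$ $$\lambda^2\partial_x^2\phi^{\lambda,m+1}=n^{\lambda,m+1}+\phi^{\lambda,m+1}.$$ Characteristic roots: taking the Fourier transform in $x$ (dual variable $\xi\in\mathbb{R}$, $\partial_x\mapsto i\xi$) and eliminating $\hat\phi^{\lambda,m+1}$, the schemes become, for each $\xi$, linear recursions for $(\hat n^{\lambda,m},\hat u^{\lambda,m})$. For the EPB-based scheme: $$\delta^{-1}(\hat n^{\lambda,m+1}-\hat n^{\lambda,m})+i\xi\,\hat u^{\lambda,m}+\beta\xi^2\hat n^{\lambda,m}=0,\qquad \delta^{-1}(\hat u^{\lambda,m+1}-\hat u^{\lambda,m})+\frac{i\xi}{1+\lambda^2\xi^2}\hat n^{\lambda,m+1}+\beta\xi^2\hat u^{\lambda,m}=0.$$ For the REPB-based scheme: $$\delta^{-1}(\hat n^{\lambda,m+1}-\hat n^{\lambda,m})+i\xi\,\hat u^{\lambda,m}+\beta\xi^2\hat n^{\lambda,m}=0,\qquad \delta^{-1}(\hat u^{\lambda,m+1}-\hat u^{\lambda,m})+i\xi\,\hat n^{\lambda,m}-\frac{i\lambda^2\xi^3}{1+\lambda^2\xi^2}\hat n^{\lambda,m+1}+\beta\xi^2\hat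 u^{\lambda,m}=0.$$ The characteristic roots $q^\lambda_\pm(\xi)\in\mathbb{C}$ are the two roots (with multiplicity) of the characteristic equation of the corresponding recursion, i.e. the eigenvalues of the matrix mapping $(\hat n^{\lambda,m},\hat u^{\lambda,m})$ to $(\hat n^{\lambda,m+1},\hat u^{\lambda,m+1})$. Explicitly, for the EPB-based scheme they are the roots $q$ of $$q^2-2q\Big(1-\beta\xi^2\delta-\frac{\xi^2\delta^2}{2(1+\lambda^2\xi^2)}\Big)+(1-\beta\xi^2\delta)^2=0,$$ and for the REPB-based scheme they are the roots $q$ of $$q^2-2q\Big(1-\beta\xi^2\delta+\frac{\lambda^2\xi^4\delta^2}{2(1+\lambda^2\xi^2)}\Big)+(1-\beta\xi^2\delta)^2+\xi^2\delta^2=0.$$ Definition of stability: a scheme is called stable if and only if $|q^\lambda_\pm(\xi)|\le 1$ for all $\xi$ such that $|\xi|<\pi/h$. *)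

(* Defs.v *)
From mathcomp Require Import all_boot all_order all_algebra.
From mathcomp Require Import ring complex.
From mathcomp Require Import reals trigo.

Set Implicit Arguments.
Unset Strict Implicit.
Unset Printing Implicit Defensive.

Import Order.TTheory GRing.Theory Num.Theory.

Local Open Scope ring_scope.
Local Open Scope complex_scope.

(* One time step of the schemes, from (n, u) to (n', u', phi').  The space
   V of unknowns and the derivation D are parameters: D = d/dx on functions of
   x gives the schemes in physical space, D = multiplication by i xi gives
   their Fourier transforms. *)
Section Schemes.
Variables (K : fieldType) (V : lmodType K) (D : V -> V).
Variables (lambda delta beta : K).
Implicit Types n u phi : V.

Definition epb_scheme n u n' u' phi' : Prop :=
  [/\ delta^-1 *: (n' - n) + D u - beta *: D (D n) = 0,
      delta^-1 *: (u' - u) - beta *: D (D u) = D phi'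
    & lambda ^+ 2 *: D (D phi') = n' + phi'].

Definition repb_scheme n u n' u' phi' : Prop :=
  [/\ delta^-1 *: (n' - n) + D u - beta *: D (D n) = 0,
      delta^-1 *: (u' - u) + D n - beta *: D (D u)
        = lambda ^+ 2 *: D (D (D phi'))
    & lambda ^+ 2 *: D (D phi') = n' + phi'].
End Schemes.

Section Fourier.
Variable R : realType.
Implicit Types (lambda delta beta xi h : R).

Definition mx2 (a b c d : R[i]) : 'M[R[i]]_2 :=
  \matrix_(i < 2, j < 2)
    if i == 0 then (if j == 0 then a else b) else (if j == 0 then c else d).

Definition col2 (a b : R[i]) : 'cV[R[i]]_2 := \col_(i < 2) if i == 0 then a else b.

Definition dx_hat xi : R[i]^o -> R[i]^o := fun z => 'i * xi%:C * z.

(* Obtained by eliminating phi' = - n' / (1 + lambda^2 xi^2), then substituting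
   n' = (1 - beta xi^2 delta) n - i xi delta u into the velocity equation;
   validated by epb_matrixP and repb_matrixP. *)
Definition epb_matrix lambda delta beta xi : 'M[R[i]]_2 :=
  let a := 1 - beta * xi ^+ 2 * delta in
  let k := 1 + lambda ^+ 2 * xi ^+ 2 in
  mx2 a%:C                                (- 'i * (xi * delta)%:C)
      (- 'i * (xi * delta * a / k)%:C)    (a - xi ^+ 2 * delta ^+ 2 / k)%:C.

Definition repb_matrix lambda delta beta xi : 'M[R[i]]_2 :=
  let a := 1 - beta * xi ^+ 2 * delta in
  let k := 1 + lambda ^+ 2 * xi ^+ 2 in
  mx2 a%:C
      (- 'i * (xi * delta)%:C)
      ('i * (lambda ^+ 2 * xi ^+ 3 * delta * a / k - xi * delta)%:C)
      (a + lambda ^+ 2 * xi ^+ 4 * delta ^+ 2 / k)%:C.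

(* q ranges over all characteristic roots; `|q| is the modulus, as an element
   of R[i], so that `|q| <= 1 is the order of R[i] restricted to reals. *)
Definition stable (M : R -> 'M[R[i]]_2) h : Prop :=
  forall xi, `|xi| < pi / h ->
  forall q : R[i], root (char_poly (M xi)) q -> `|q| <= 1.

Definition epb_stable lambda delta beta h : Prop :=
  stable (epb_matrix lambda delta beta) h.

Definition repb_stable lambda delta beta h : Prop :=
  stable (repb_matrix lambda delta beta) h.

(* M is the matrix mapping (n, u) to (n', u') for a given step relation. *)
Definition amplifies
    (step : R[i] -> R[i] -> R[i] -> R[i] -> R[i] -> Prop) (M : 'M[R[i]]_2) :=
  forall n u n' u',
    (exists phi', step n u n' u' phi') <-> col2 n' u' = M *m col2 n u.

Lemma col2_mul a b c d n u n' u' :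
  col2 n' u' = mx2 a b c d *m col2 n u
  <-> n' = a * n + b * u /\ u' = c * n + d * u.
Proof.
split=> [/matrixP e|[-> ->]].
  have := e 0 0; have := e 1 0.
  by rewrite !mxE !big_ord_recl !big_ord0 !mxE /= !addr0 => -> ->.
apply/matrixP => i j; rewrite !mxE !big_ord_recl !big_ord0 !mxE /= !addr0.
by case: ifP.
Qed.

Let sqri : ('i : R[i]) ^+ 2 = -1.
Proof. exact: sqr_i. Qed.

Let cD (x y : R) : (x + y)%:C = x%:C + y%:C. Proof. exact: rmorphD. Qed.
Let cB (x y : R) : (x - y)%:C = x%:C - y%:C. Proof. exact: rmorphB. Qed.
Let cM (x y : R) : (x * y)%:C = x%:C * y%:C. Proof. exact: rmorphM. Qed.
Let cV (x : R) : (x^-1)%:C = x%:C^-1. Proof. exact: fmorphV. Qed.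
Let cX (x : R) k : (x ^+ k)%:C = x%:C ^+ k. Proof. exact: rmorphXn. Qed.
Let cn k : (k%:R : R)%:C = k%:R. Proof. exact: rmorph_nat. Qed.
Let cE := (cB, cM, cV, cX, cn, cn 1, cD).

Let k_neq0 lambda xi : 1 + (lambda%:C : R[i]) ^+ 2 * xi%:C ^+ 2 != 0.
Proof.
rewrite -!rmorphXn -rmorphM -(rmorph1 (real_complex R)) -rmorphD fmorph_eq0.
by rewrite gt_eqF// ltr_pwDl// mulr_ge0// sqr_ge0.
Qed.

Let poissonE (l x n phi : R[i]) : 1 + l ^+ 2 * x ^+ 2 != 0 ->
  l ^+ 2 * ('i * x * ('i * x * phi)) = n + phi
  <-> phi = - n / (1 + l ^+ 2 * x ^+ 2).
Proof.
move=> k0.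
have -> : l ^+ 2 * ('i * x * ('i * x * phi))
    = 'i ^+ 2 * (l ^+ 2 * x ^+ 2 * phi) by ring.
rewrite sqri mulN1r; split=> [e|->]; last by field; rewrite ?exprMn ?k0 ?d0.
apply: (mulIf k0); rewrite divfK//.
have -> : n = - (l ^+ 2 * x ^+ 2 * phi) - phi by rewrite e; ring.
by ring.
Qed.

Let densityE (d x b n u n' : R[i]) : d != 0 ->
  d^-1 * (n' - n) + 'i * x * u - b * ('i * x * ('i * x * n)) = 0
  <-> n' = (1 - b * x ^+ 2 * d) * n - 'i * (x * d) * u.
Proof.
move=> d0; have -> : b * ('i * x * ('i * x * n)) = 'i ^+ 2 * (b * x ^+ 2 * n).
  by ring.
rewrite sqri mulN1r; split=> [e|->]; last by field; rewrite ?exprMn ?k0 ?d0.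
apply/eqP; rewrite -subr_eq0; apply/eqP.
by rewrite -[RHS](mulr0 d) -e; field.
Qed.

Let velocityE (d x b s t u u' : R[i]) : d != 0 ->
  d^-1 * (u' - u) + s - b * ('i * x * ('i * x * u)) = t
  <-> u' = (1 - b * x ^+ 2 * d) * u - d * s + d * t.
Proof.
move=> d0; have -> : b * ('i * x * ('i * x * u)) = 'i ^+ 2 * (b * x ^+ 2 * u).
  by ring.
rewrite sqri mulN1r; split=> [<-|->]; by field.
Qed.

Let delta_neq0 delta : 0 < delta -> (delta%:C : R[i]) != 0.
Proof. by move=> d0; rewrite fmorph_eq0 gt_eqF. Qed.

Lemma epb_matrixP lambda delta beta xi : 0 < delta ->
  amplifies (epb_scheme (dx_hat xi) lambda%:C delta%:C beta%:C)
            (epb_matrix lambda delta beta xi).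
Proof.
move=> /delta_neq0 d0 n u n' u'; have := k_neq0 lambda xi.
rewrite /epb_matrix col2_mul /epb_scheme /dx_hat.
rewrite !cE.
move: lambda%:C delta%:C beta%:C xi%:C d0 => l d b x d0 k0.
have alg s t : n' = (1 - b * x ^+ 2 * d) * n
      - 'i * (x * d) * u ->
    s = 0 -> t = 'i * x * (- n' / (1 + l ^+ 2 * x ^+ 2)) ->
    (1 - b * x ^+ 2 * d) * u - d * s + d * t
    = - 'i * (x * d * (1 - b * x ^+ 2 * d) /
        (1 + l ^+ 2 * x ^+ 2)) * n +
      (1 - b * x ^+ 2 * d
        - x ^+ 2 * d ^+ 2 / (1 + l ^+ 2 * x ^+ 2)) * u.
  move=> -> -> ->.
  transitivity ((1 - b * x ^+ 2 * d) * u
    - 'i * (x * d * (1 - b * x ^+ 2 * d) /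
        (1 + l ^+ 2 * x ^+ 2)) * n
    + 'i ^+ 2 * (x ^+ 2 * d ^+ 2 /
        (1 + l ^+ 2 * x ^+ 2) * u)); first by field; rewrite ?exprMn ?k0 ?d0.
  by rewrite sqri; field; rewrite ?exprMn ?k0 ?d0.
split=> [[phi [/(densityE _ _ _ _ _ d0) e1 e2 /(poissonE _ _ k0) e3]]|[e1 e2]].
  split; first by rewrite e1; ring.
  rewrite -(alg 0 ('i * x * phi)) -?e3//; apply/velocityE => //.
  by rewrite addr0.
have e1' : n' = (1 - b * x ^+ 2 * d) * n
  - 'i * (x * d) * u by rewrite e1; ring.
exists (- n' / (1 + l ^+ 2 * x ^+ 2)); split.
- exact/densityE.
- rewrite -[X in X - _]addr0; apply/velocityE => //.
  by rewrite e2 -(alg 0 _ e1' erefl erefl).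
- exact/poissonE.
Qed.

Lemma repb_matrixP lambda delta beta xi : 0 < delta ->
  amplifies (repb_scheme (dx_hat xi) lambda%:C delta%:C beta%:C)
            (repb_matrix lambda delta beta xi).
Proof.
move=> /delta_neq0 d0 n u n' u'; have := k_neq0 lambda xi.
rewrite /repb_matrix col2_mul /repb_scheme /dx_hat.
rewrite !cE.
move: lambda%:C delta%:C beta%:C xi%:C d0 => l d b x d0 k0.
have alg phi : n' = (1 - b * x ^+ 2 * d) * n
      - 'i * (x * d) * u ->
    phi = - n' / (1 + l ^+ 2 * x ^+ 2) ->
    (1 - b * x ^+ 2 * d) * u - d * ('i * x * n)
      + d *
        (l ^+ 2 * ('i * x * ('i * x * ('i * x * phi))))
    = 'i * (l ^+ 2 * x ^+ 3 * d *
        (1 - b * x ^+ 2 * d) /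
        (1 + l ^+ 2 * x ^+ 2) - x * d) * n +
      (1 - b * x ^+ 2 * d
        + l ^+ 2 * x ^+ 4 * d ^+ 2 /
          (1 + l ^+ 2 * x ^+ 2)) * u.
  move=> -> ->.
  transitivity ((1 - b * x ^+ 2 * d) * u
    - d * ('i * x * n)
    - 'i ^+ 2 * 'i * (l ^+ 2 * x ^+ 3 * d *
        (1 - b * x ^+ 2 * d) /
        (1 + l ^+ 2 * x ^+ 2)) * n
    + 'i ^+ 2 * 'i ^+ 2 * (l ^+ 2 * x ^+ 4 * d ^+ 2 /
        (1 + l ^+ 2 * x ^+ 2) * u)); first by field; rewrite ?exprMn ?k0 ?d0.
  by rewrite sqri; field; rewrite ?exprMn ?k0 ?d0.
split=> [[phi [/(densityE _ _ _ _ _ d0) e1 e2 /(poissonE _ _ k0) e3]]|[e1 e2]].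
  split; first by rewrite e1; ring.
  by rewrite -(alg phi)//; apply/velocityE.
have e1' : n' = (1 - b * x ^+ 2 * d) * n
  - 'i * (x * d) * u by rewrite e1; ring.
exists (- n' / (1 + l ^+ 2 * x ^+ 2)); split.
- exact/densityE.
- by apply/velocityE => //; rewrite e2 -(alg _ e1' erefl).
- exact/poissonE.
Qed.

Lemma root_char_mx2 a b c d q :
  root (char_poly (mx2 a b c d)) q
  = (q ^+ 2 - (a + d) * q + (a * d - b * c) == 0).
Proof.
rewrite /root /char_poly (expand_det_row _ 0) !big_ord_recl big_ord0 /cofactor.
rewrite !det_mx11 !mxE /= !hornerE /=; congr (_ == 0).
by ring.
Qed.

Lemma root_epb lambda delta beta xi q :
  root (char_poly (epb_matrix lambda delta beta xi)) q
  = (q ^+ 2 - 2 * q * (1 - beta * xi ^+ 2 * delta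
        - xi ^+ 2 * delta ^+ 2 / (2 * (1 + lambda ^+ 2 * xi ^+ 2)))%:C
     + ((1 - beta * xi ^+ 2 * delta) ^+ 2)%:C == 0).
Proof.
have k0 := k_neq0 lambda xi.
rewrite root_char_mx2.
rewrite !cE.
congr (_ == 0).
move: lambda%:C delta%:C beta%:C xi%:C k0 => L D B X k0.
transitivity (q ^+ 2 - 2 * q * (1 - B * X ^+ 2 * D
      - X ^+ 2 * D ^+ 2 / (2 * (1 + L ^+ 2 * X ^+ 2)))
  + (1 - B * X ^+ 2 * D) ^+ 2
  - (1 + 'i ^+ 2) * (X ^+ 2 * D ^+ 2 * (1 - B * X ^+ 2 * D) /
      (1 + L ^+ 2 * X ^+ 2))); first by field; rewrite ?exprMn k0 ?pnatr_eq0.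
by rewrite sqri subrr mul0r subr0.
Qed.

Lemma root_repb lambda delta beta xi q :
  root (char_poly (repb_matrix lambda delta beta xi)) q
  = (q ^+ 2 - 2 * q * (1 - beta * xi ^+ 2 * delta
        + lambda ^+ 2 * xi ^+ 4 * delta ^+ 2
          / (2 * (1 + lambda ^+ 2 * xi ^+ 2)))%:C
     + ((1 - beta * xi ^+ 2 * delta) ^+ 2 + xi ^+ 2 * delta ^+ 2)%:C == 0).
Proof.
have k0 := k_neq0 lambda xi.
rewrite root_char_mx2.
rewrite !cE.
congr (_ == 0).
move: lambda%:C delta%:C beta%:C xi%:C k0 => L D B X k0.
transitivity (q ^+ 2 - 2 * q * (1 - B * X ^+ 2 * D
      + L ^+ 2 * X ^+ 4 * D ^+ 2 / (2 * (1 + L ^+ 2 * X ^+ 2)))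
  + ((1 - B * X ^+ 2 * D) ^+ 2 + X ^+ 2 * D ^+ 2)
  + (1 + 'i ^+ 2) * (L ^+ 2 * X ^+ 4 * D ^+ 2 * (1 - B * X ^+ 2 * D) /
      (1 + L ^+ 2 * X ^+ 2) - X ^+ 2 * D ^+ 2));
  first by field; rewrite ?exprMn k0 ?pnatr_eq0.
by rewrite sqri subrr mul0r addr0.
Qed.
End Fourier.

(* Main.v *)
(** A real quadratic q^2 - 2 s q + p has both roots in the closed unit disc as
    soon as p <= 1 and |2 s| <= 1 + p (Jury's criterion).  Put
    b = c h xi^2 delta, the damping of the numerical viscosity, and
    w = xi^2 delta^2.  For |xi| < pi / h < 4 / h and delta small with respect
    to h one has b <= 1 and w <= min(b, 1), and the criterion reduces to
    0 <= b^2 + e and e <= (2 - b)^2 for the first scheme, and to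
    b^2 + w <= 2 b and e' <= b^2 + w for the
    second, where e = w / (1 + lambda^2 xi^2) and
    e' = w - e both lie in [0, w] whatever lambda is. *)
Require Import Defs.
From mathcomp Require Import all_boot all_order all_algebra.
From mathcomp Require Import complex ring lra.
From mathcomp Require Import reals trigo.

Import Order.TTheory GRing.Theory Num.Theory.

Local Open Scope ring_scope.

(** With [y] the other root, the hypotheses read [x * y <= 1], [(1 - x) * (1 - y) >= 0] and
    [(1 + x) * (1 + y) >= 0]. If [x > 1] then [y >= 1], and if [x < -1] then [y <= -1]; both
    contradict [x * y <= 1]. *)
Lemma jury_real (R : realFieldType) (s p x : R) :
  p <= 1 -> 2 * s <= 1 + p -> - (2 * s) <= 1 + p ->
  x ^+ 2 - 2 * s * x + p = 0 -> x ^+ 2 <= 1.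
Proof.
move=> p1 sp Nsp e.
have [y sE] : exists y, 2 * s = x + y by exists (2 * s - x); ring.
have pE : p = x * y.
  by apply/eqP; rewrite -subr_eq0 -e sE; apply/eqP; ring.
rewrite {}sE {}pE {e} in p1 sp Nsp *.
have [x1|x1] := ltP 1 x; first by nra.
have [x2|x2] := ltP x (-1); first by nra.
nra.
Qed.

Lemma jury (R : rcfType) (s p : R) (q : R[i]) :
  p <= 1 -> 2 * s <= 1 + p -> - (2 * s) <= 1 + p ->
  q ^+ 2 - 2 * q * (s%:C)%C + (p%:C)%C = 0 -> `|q| <= 1.
Proof.
case: q => x y p1 sp Nsp; rewrite mulrAC -mulrA.
have -> : 2 * ((s%:C)%C * Complex x y) = Complex (2 * s * x) (2 * s * y) :> R[i].
  rewrite -[2 : R[i]](rmorph_nat (real_complex R)).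
  by apply/eqP; rewrite eq_complex /=; apply/andP; split; apply/eqP; ring.
move=> /eqP; rewrite expr2 eq_complex /= => /andP[/eqP re /eqP im].
rewrite normc_def /= lecR -[leRHS]sqrtr1 ler_wsqrtr//.
(* The imaginary part leaves two cases: [x = s], where the real part gives [x ^+ 2 + y ^+ 2 = p], or
   a real root. *)
have /eqP : (x - s) * y = 0 by lra.
rewrite mulf_eq0 => /orP[|] /eqP h; first by nra.
rewrite h [0 ^+ 2]expr0n addr0; apply: (@jury_real _ s p) => //.
by rewrite -re h; ring.
Qed.

Lemma pi_lt4 (R : realType) : pi < 4 :> R.
Proof. by have := pihalf_lt2 R; lra. Qed.

Lemma sqr_wave_number_lt (R : realType) (h xi : R) :
  0 < h -> `|xi| < pi / h -> (xi * h) ^+ 2 < 16.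
Proof.
move=> h0; rewrite ltr_pdivlMr// => xih.
have {}xih : `|xi * h| < 4.
  by rewrite normrM (gtr0_norm h0) (lt_trans xih)// pi_lt4.
by move: xih; rewrite ltr_norml => /andP[]; nra.
Qed.

(** Each entry of the minimum yields one upper bound: since [(xi * h) ^+ 2 < 16], [1 / 4] gives
    [w <= 1] and [1 / (16 * c)] gives [b <= 1], while [c] gives [w <= b]. *)
Lemma damping_bounds (R : realType) (c h delta xi : R) :
  0 < c -> 0 < h -> 0 < delta -> `|xi| < pi / h ->
  delta <= Num.min (1 / 4) (Num.min c (1 / (16 * c))) * h ->
  [/\ 0 <= c * h * xi ^+ 2 * delta <= 1,
      0 <= xi ^+ 2 * delta ^+ 2,
      xi ^+ 2 * delta ^+ 2 <= 1
    & xi ^+ 2 * delta ^+ 2 <= c * h * xi ^+ 2 * delta].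
Proof.
move=> c0 h0 d0 /(sqr_wave_number_lt _ _ _ h0) xih dC.
have dle t : Num.min (1 / 4) (Num.min c (1 / (16 * c))) <= t -> delta <= t * h.
  by move=> Ct; rewrite (le_trans dC)// ler_wpM2r// ltW.
have d4 : delta <= 1 / 4 * h by apply: dle; rewrite ge_min lexx.
have dc : delta <= c * h by apply: dle; rewrite !ge_min lexx orbT.
have cd : 16 * (c * delta) <= h.
  have : delta <= 1 / (16 * c) * h by apply: dle; rewrite !ge_min lexx !orbT.
  by rewrite mulrAC mul1r ler_pdivlMr ?mulr_gt0// mulrC mulrA.
rewrite exprMn in xih; move: (sqr_ge0 xi) xih; move: (xi ^+ 2) => X x0 xih.
split.
- apply/andP; split; first by rewrite !mulr_ge0// ltW.
  have -> : c * h * X * delta = h * X * (c * delta) by ring.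
  have : h * X * (16 * (c * delta)) <= h * X * h.
    by rewrite ler_wpM2l// mulr_ge0// ltW.
  by nra.
- by rewrite mulr_ge0// sqr_ge0.
- have : X * delta ^+ 2 <= X * (1 / 4 * h) ^+ 2.
    by rewrite ler_wpM2l// ler_sqr// nnegrE ?(ltW d0)// (le_trans (ltW d0)).
  by rewrite exprMn; nra.
- have -> : c * h * X * delta = X * (delta * (c * h)) by ring.
  by rewrite expr2 !ler_wpM2l// ltW.
Qed.

Theorem proposition2 (R : realType) (c : R) (c_gt0 : 0 < c) :
  (exists2 C : R, 0 < C &
     forall h delta lambda : R, 0 < h -> 0 < delta -> 0 < lambda ->
       delta <= C * h -> epb_stable lambda delta (c * h) h)
  /\
  (exists2 C : R, 0 < C &
     forall h delta lambda : R, 0 < h -> 0 < delta -> 0 < lambda ->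
       delta <= C * h -> repb_stable lambda delta (c * h) h).
Proof.
have C_gt0 : 0 < Num.min (1 / 4) (Num.min c (1 / (16 * c))).
  by rewrite !lt_min c_gt0 !divr_gt0// mulr_gt0.
have k_ge1 l xi : 1 <= 1 + l ^+ 2 * xi ^+ 2 :> R.
  by rewrite lerDl mulr_ge0// sqr_ge0.
split; exists (Num.min (1 / 4) (Num.min c (1 / (16 * c)))) => //.
  move=> h delta lambda h0 d0 _ dC xi xih q; rewrite root_epb => /eqP.
  have [/andP[b0 b1] w0 w1 _] := damping_bounds _ _ _ _ _ c_gt0 h0 d0 xih dC.
  have := k_ge1 lambda xi; set k := 1 + lambda ^+ 2 * xi ^+ 2 => k1.
  have k0 : 0 < k := lt_le_trans ltr01 k1.
  set w := xi ^+ 2 * delta ^+ 2 in w0 w1 *.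
  set b := c * h * xi ^+ 2 * delta in b0 b1 *.
  have -> : w / (2 * k) = w / k / 2 by field; rewrite gt_eqF.
  have e0 : 0 <= w / k by rewrite divr_ge0// ltW.
  have e1 : w / k <= 1 by rewrite ler_pdivrMr// mul1r (le_trans w1).
  (* As [b <= 1], [(2 - b) ^+ 2 >= 1 >= w / k]. *)
  by apply: jury; nra.
move=> h delta lambda h0 d0 _ dC xi xih q; rewrite root_repb => /eqP.
have [/andP[b0 b1] w0 _ wb] := damping_bounds _ _ _ _ _ c_gt0 h0 d0 xih dC.
have := k_ge1 lambda xi; set k := 1 + lambda ^+ 2 * xi ^+ 2 => k1.
have k0 : 0 < k := lt_le_trans ltr01 k1.
(* Since [lambda ^+ 2 * xi ^+ 2 / k = 1 - 1 / k], this term stays in [[0, w / 2]] uniformly in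
   [lambda]. *)
have -> : lambda ^+ 2 * xi ^+ 4 * delta ^+ 2 / (2 * k)
    = (xi ^+ 2 * delta ^+ 2 - xi ^+ 2 * delta ^+ 2 / k) / 2.
  by rewrite /k; field; rewrite exprMn -/k gt_eqF.
set w := xi ^+ 2 * delta ^+ 2 in w0 wb *.
set b := c * h * xi ^+ 2 * delta in b0 b1 wb *.
have e0 : 0 <= w / k by rewrite divr_ge0// ltW.
have ew : w / k <= w by rewrite ler_pdivrMr// ler_peMr.
(* The bound [p <= 1] adds [b ^+ 2 <= b] and [w <= b]: viscosity absorbs the excess [w]. *)
by apply: jury; nra.
Qed.
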